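(* Let $s \ge 1$ and let $H \subset \ell_{00}(\mathbb{Z}^s)$ be a finite zero dimensional set of impulse responses with zero set $\Theta^{-1} = \{\theta^{-1} : \theta \in \Theta\}$, $\Theta \subset \mathbb{C}_\times^s$ finite, and multiplicity spaces $\mathcal{Q}_\theta \subset \Pi$, $\theta \in \Theta$. Then $$ \ker H = \bigoplus_{\theta \in \Theta} \mathcal{P}_\theta \, e_\theta, \qquad \mathcal{P}_\theta := \sigma_- L^{-1} \sigma_\theta \mathcal{Q}_\theta , $$ where $\ker H := \{ c \in \ell(\mathbb{Z}^s) : h * c = 0 \text{ for all } h \in H\}$.
   Context: Notation: $\mathbb{C}_\times^s := (\mathbb{C}\setminus\{0\})^s$; $\theta^{-1} := (\theta_1^{-1},\dots,\theta_s^{-1})$; $\ell(\mathbb{Z}^s)$ is the space of all functions $\mathbb{Z}^s \to \mathbb{C}$ and $\ell_{00}(\mathbb{Z}^s)$ its subspace of finitely supported functions. Convolution of $h \in \ell_{00}(\mathbb{Z}^s)$ and $c \in \ell(\mathbb{Z}^s)$: $(h*c)(\alpha) = \sum_{\beta \in \mathbb{Z}^s} h(\beta)\, c(\alpha-\beta)$. The symbol of $h$ is the Laurent polynomial $h^*(z) = \sum_{\alpha} h(\alpha) z^\alpha$. For $\theta \in \mathbb{C}_\times^s$, $e_\theta \in \ell(\mathbb{Z}^s)$ is $e_\theta(\alpha) = \theta^\alpha = \theta_1^{\alpha_1}\cdots\theta_s^{\alpha_s}$. $\Pi = \mathbb{C}[z_1,\dots,z_s]$. For $q = \sum_\alpha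 q_\alpha z^\alpha \in \Pi$ let $q(D) = \sum_\alpha q_\alpha \, \partial^{|\alpha|}/\partial z^\alpha$. A subspace $\mathcal{Q} \subseteq \Pi$ is $D$-invariant if $q(D)p \in \mathcal{Q}$ for all $p \in \mathcal{Q}$, $q \in \Pi$. For a space $\mathcal{P} \subseteq \Pi$, $\mathcal{P} e_\theta$ is the set of sequences $\alpha \mapsto p(\alpha)\theta^\alpha$, $p \in \mathcal{P}$. Zero dimensional sets: let $\langle H^*\rangle$ be the ideal generated by $\{h^* : h \in H\}$ in the ring of Laurent polynomials in $z_1,\dots,z_s$ over $\mathbb{C}$ (only common zeros in $\mathbb{C}_\times^s$ are counted). $H$ is zero dimensional with zero set $\Theta^{-1}$ and multiplicity spaces $\mathcal{Q}_\theta$ if $\Theta \subset \mathbb{C}_\times^s$ is finite, the $\mathcal{Q}_\theta$ are nonzero finite dimensional $D$-invariant subspaces of $\Pi$, and a Laurent polynomial $f$ belongs to $\langle H^*\rangle$ if and only if $(q(D)f)(\theta^{-1}) = 0$ for all $q \in \mathcal{Q}_\theta$ and all $\theta \in \Theta$. Operators on $\Pi$: $\Delta^\gamma$ is the forward difference operator with unit steps, $\Delta^0 = I$, $\Delta^{\gamma+\epsilon_j} f = (\Delta^\gamma f)(\cdot+\epsilon_j) - \Delta^\gamma f$, $\epsilon_j$ the $j$th unit vector; $L : \Pi \to \Pi$ is $L f(x) = \sum_{|\gamma| \le \deg f} \frac{1}{\gamma!} \Delta^\gamma f(0)\, x^\gamma$, a linear bijection of $\Pi$; $\sigma_\theta f(z)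 = f(\theta_1 z_1,\dots,\theta_s z_s)$ and $\sigma_- = \sigma_{(-1,\dots,-1)}$, i.e. $\sigma_- f(z) = f(-z)$. *)

(* Defs.v *)
(* The field of complex numbers is R[i] with R : realType. *)
From HB Require Import structures.
From mathcomp Require Import all_boot all_order all_algebra.
From mathcomp Require Import finmap complex.
From mathcomp Require Import boolp classical_sets functions reals.
From mathcomp.multinomials Require Import freeg mpoly.

Set Implicit Arguments.
Unset Strict Implicit.
Unset Printing Implicit Defensive.

Import Order.TTheory GRing.Theory Num.Theory.

Local Open Scope ring_scope.
Local Open Scope classical_set_scope.

Notation ell R s := ({ffun 'I_s -> int} -> R[i]).
Notation ell00 R s := {fsfun {ffun 'I_s -> int} -> R[i] with 0}.
Notation Cpoly R s := {mpoly R[i][s]}.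

(* A Laurent polynomial is a formal C-linear combination of the exponents
   a : Z^s, << c *g a >> being the term c z^a. *)
Notation laurent R s := {freeg {ffun 'I_s -> int} / R[i]}.

Section Subspaces.
Context {K : fieldType} {V : lmodType K}.

Definition subspace (U : set V) : Prop :=
  U 0 /\ forall (a : K) (u v : V), U u -> U v -> U (a *: u + v).

Definition finite_dim (U : set V) : Prop :=
  exists b : seq V, forall u, U u ->
    exists c : nat -> K, u = \sum_(i < size b) c i *: b`_i.

Definition is_direct_sum (I : choiceType) (S : {fset I}) (U : I -> set V)
    (W : set V) : Prop :=
  [/\ forall i, i \in S -> subspace (U i),
      W = [set w | exists2 u : I -> V,
             forall i, i \in S -> U i (u i) & w = \sum_(i <- S) u i]
    & forall u v : I -> V,
        (forall i, i \in S -> U i (u i)) ->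
        (forall i, i \in S -> U i (v i)) ->
        \sum_(i <- S) u i = \sum_(i <- S) v i ->
        forall i, i \in S -> u i = v i].

End Subspaces.

(* T_1^(m 1) o ... o T_s^(m s), used below for commuting operators only; same
   recursion as mderivm. *)
Definition multi_iter (s : nat) (A : Type) (T : 'I_s -> A -> A)
    (m : 'X_{1..s}) (x : A) : A :=
  foldr (fun i => iter (m i) (T i)) x (enum 'I_s).

Section Setting.
Variables (R : realType) (s : nat).

Local Notation C := R[i].
Local Notation Zs := {ffun 'I_s -> int}.
Local Notation Cs := {ffun 'I_s -> C}.
Local Notation Pi := (Cpoly R s).

Definition monom (z : Cs) (a : Zs) : C := \prod_i z i ^ a i.

Definition e_ (theta : Cs) : ell R s := fun a => monom theta a.

Definition inv_pt (theta : Cs) : Cs := [ffun i => (theta i)^-1].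

Definition conv (h : ell00 R s) (c : ell R s) : ell R s :=
  fun a => \sum_(b <- finsupp h) h b * c (a - b).

Definition kernel (H : {fset ell00 R s}) : set (ell R s) :=
  [set c | forall h, h \in H -> conv h c = 0].

Definition symbol (h : ell00 R s) : laurent R s :=
  \sum_(a <- finsupp h) << h a *g a >>.

Definition lmul (f g : laurent R s) : laurent R s :=
  \sum_(a <- dom f) \sum_(b <- dom g) << coeff a f * coeff b g *g a + b >>.

Definition leval (f : laurent R s) (z : Cs) : C :=
  \sum_(a <- dom f) coeff a f * monom z a.

Definition lideal (S : set (laurent R s)) : set (laurent R s) :=
  [set f | exists n (g h : 'I_n -> laurent R s),
     (forall i, S (h i)) /\ f = \sum_i lmul (g i) (h i)].

Definition unitZ (j : 'I_s) : Zs := [ffun i => (i == j)%:R].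

Definition lderiv (j : 'I_s) (f : laurent R s) : laurent R s :=
  \sum_(a <- dom f) << coeff a f * (a j)%:~R *g a - unitZ j >>.

Definition lapplyD (q : Pi) (f : laurent R s) : laurent R s :=
  \sum_(m <- msupp q) q@_m *: multi_iter lderiv m f.

Definition applyD (q p : Pi) : Pi := \sum_(m <- msupp q) q@_m *: mderivm m p.

Definition D_invariant (Q : set Pi) : Prop :=
  forall p q : Pi, Q p -> Q (applyD q p).

(* [Q theta] is relevant only for [theta \in Theta]. *)
Record zero_dimensional (H : {fset ell00 R s}) (Theta : {fset Cs})
    (Q : Cs -> set Pi) : Prop := ZeroDimensional {
  zd_pts : forall theta, theta \in Theta -> forall i, theta i != 0;
  zd_subspace : forall theta, theta \in Theta -> subspace (Q theta);
  zd_nonzero : forall theta, theta \in Theta -> exists2 q, Q theta q & q != 0;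
  zd_finite_dim : forall theta, theta \in Theta -> finite_dim (Q theta);
  zd_D_invariant : forall theta, theta \in Theta -> D_invariant (Q theta);
  zd_ideal : forall f : laurent R s,
    lideal [set symbol h | h in [set` H]] f <->
    forall theta, theta \in Theta -> forall q, Q theta q ->
      leval (lapplyD q f) (inv_pt theta) = 0
}.

Definition fdiff (j : 'I_s) (f : Pi) : Pi :=
  f \mPo [tuple 'X_i + (i == j)%:R | i < s] - f.

Definition mnm_fact (m : 'X_{1..s}) : nat := (\prod_i (m i)`!)%N.

(* [msize f] is 1 + deg f, so the sum is over |m| <= deg f. *)
Definition opL (f : Pi) : Pi :=
  \sum_(m : 'X_{1..s < msize f})
    ((mnm_fact m)%:R^-1 * (multi_iter fdiff m f).@[fun=> 0]) *: 'X_[m].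

Definition sigma (theta : Cs) (f : Pi) : Pi :=
  f \mPo [tuple theta i *: 'X_i | i < s].

(* As opL is a linear bijection, the preimage under opL is the image under its
   inverse. *)
Definition P_ (Q : Cs -> set Pi) (theta : Cs) : set Pi :=
  sigma [ffun=> -1] @` (opL @^-1` (sigma theta @` Q theta)).

Definition exp_space (P : set Pi) (theta : Cs) : set (ell R s) :=
  [set (fun a : Zs => p.@[fun i => (a i)%:~R] * e_ theta a) | p in P].

End Setting.

(* Main.v *)
(* The sequence space is the dual of the Laurent polynomials, and [ker H] is
   the annihilator of the ideal of [H].  This ideal is by hypothesis the
   annihilator of the functionals [f |-> (q(D) f)(theta^-1)], which span a
   finite dimensional space, so [ker H] is that span.  Applying [q(D)] to the
   monomials produces falling factorials, and [L^-1] is exactly the map sending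
   [x^m] to the falling factorial of [x] (Newton interpolation); hence the
   functional of [q] is the sequence of [sigma_- L^-1 sigma_theta q] times
   [e_theta].  The sum is direct because iterates of
   [c |-> c (_ + unitZ j) - theta j * c] kill polynomials times [e_theta] and
   are injective on polynomials times [e_t] whenever [t j != theta j]. *)
From HB Require Import structures.
Require Import Defs.
From mathcomp Require Import all_boot all_order all_algebra.
From mathcomp Require Import finmap complex ring.
From mathcomp Require Import boolp classical_sets functions reals.
From mathcomp.multinomials Require Import freeg mpoly.

Set Implicit Arguments.
Unset Strict Implicit.
Unset Printing Implicit Defensive.

Import Order.TTheory GRing.Theory Num.Theory.

Local Open Scope ring_scope.
Local Open Scope classical_set_scope.

(** * Linear extension from a basis *)

Section FreegLift.
Context (R : nzRingType) (K : choiceType) (M : lmodType R) (f : K -> M).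

HB.instance Definition _ :=
  GRing.isZmodMorphism.Build {freeg K / R} M (fglift f) (lift_is_additive f).

Lemma fglift_is_scalable : scalable (fglift f).
Proof.
move=> c D; have -> : c *: D = \sum_(x <- dom D) << c * coeff x D *g x >> by [].
rewrite -[D in RHS]freeg_sumE !raddf_sum; apply: eq_bigr => x _ /=.
by rewrite !liftU scalerA.
Qed.

HB.instance Definition _ :=
  GRing.isScalable.Build R {freeg K / R} M *:%R (fglift f) fglift_is_scalable.

Lemma fgliftE (D : {freeg K / R}) :
  fglift f D = \sum_(x <- dom D) coeff x D *: f x.
Proof.
rewrite -{1}(freeg_sumE D) raddf_sum; apply: eq_bigr => x _ /=.
exact: liftU.
Qed.

End FreegLift.

Section MpolyLift.
Context (R : nzRingType) (n : nat) (M : lmodType R) (F : 'X_{1..n} -> M).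

Definition mlift (q : {mpoly R[n]}) : M := \sum_(m <- msupp q) q@_m *: F m.

(** The support varies with [q]; linearity comes from [fglift] on the free module underlying the
    polynomials. *)
Lemma mlift_is_linear : linear mlift.
Proof.
have E q : mlift q = fglift F (mpoly_val q) by rewrite fgliftE.
by move=> a p q; rewrite !E -linearP.
Qed.

HB.instance Definition _ :=
  GRing.isLinear.Build R {mpoly R[n]} M *:%R mlift mlift_is_linear.

Lemma mliftX m : mlift 'X_[m] = F m.
Proof. by rewrite /mlift msuppX big_seq1 mcoeffX eqxx scale1r. Qed.

Lemma mlift_unique (g : {linear {mpoly R[n]} -> M}) :
  (forall m, g 'X_[m] = F m) -> g =1 mlift.
Proof.
move=> gF q; rewrite {1}[q]mpolyE raddf_sum; apply: eq_bigr => m _.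
by rewrite -gF; apply: linearZ.
Qed.

End MpolyLift.

(** * Falling factorials *)

Definition ffall (A : pzRingType) (x : A) (n : nat) := \prod_(k < n) (x - k%:R).

Section Falling.
Context {A : comPzRingType}.
Implicit Types (x : A) (n : nat).

Lemma ffall0 x : ffall x 0 = 1. Proof. exact: big_ord0. Qed.

Lemma ffallSr x n : ffall x n.+1 = ffall x n * (x - n%:R).
Proof. exact: big_ord_recr. Qed.

Lemma ffallSl x n : ffall x n.+1 = x * ffall (x - 1) n.
Proof.
rewrite /ffall big_ord_recl subr0; congr (_ * _); apply: eq_bigr => k _.
by rewrite /= /bump /= natrD; ring.
Qed.

(** Discrete power rule: for [n > 0] the two products share [n - 1] factors, and the remaining ones
    differ by [n]. *)
Lemma ffall_diff x n : ffall (x + 1) n - ffall x n = n%:R * ffall x n.-1.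
Proof.
case: n => [|n]; first by rewrite !ffall0; ring.
by rewrite (ffallSl (x + 1)) addrK ffallSr -[in n.+1%:R]addn1 natrD /=; ring.
Qed.

Lemma ffall_id_ge n k : (n < k)%N -> ffall (n%:R : A) k = 0.
Proof.
by move=> nk; rewrite /ffall (bigD1 (Ordinal nk)) //= subrr mul0r.
Qed.

End Falling.

Lemma rmorph_ffall (A B : comPzRingType) (f : {rmorphism A -> B}) x n :
  f (ffall x n) = ffall (f x) n.
Proof.
rewrite rmorph_prod; apply: eq_bigr => k _.
by rewrite rmorphB rmorph_nat.
Qed.

(** * Newton interpolation and the inverse of [opL] *)

Section Newton.
Variables (R : realType) (s : nat).
Local Notation C := R[i].
Local Notation Zs := {ffun 'I_s -> int}.
Local Notation Pi := (Cpoly R s).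
Implicit Types (j : 'I_s) (m k : 'X_{1..s}) (f g p q : Pi).

Definition ffall_poly m : Pi := \prod_i ffall 'X_i (m i).

(** Explicit candidate for the inverse of [opL], confirmed by [opLK] and [newtonK]. *)
Definition newton : Pi -> Pi := mlift ffall_poly.

HB.instance Definition _ := GRing.Linear.on newton.

Lemma newtonX m : newton 'X_[m] = ffall_poly m.
Proof. exact: mliftX. Qed.

Lemma meval_ffall_poly (v : 'I_s -> C) m :
  (ffall_poly m).@[v] = \prod_i ffall (v i) (m i).
Proof.
rewrite /ffall_poly rmorph_prod.
by apply: eq_bigr => i _; rewrite rmorph_ffall /= mevalXU.
Qed.

Lemma fdiff_is_linear j : linear (@fdiff R s j).
Proof. by move=> a p q; rewrite /fdiff linearP /= scalerBr opprD addrACA. Qed.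

HB.instance Definition _ j :=
  GRing.isLinear.Build C Pi Pi *:%R (@fdiff R s j) (fdiff_is_linear j).

Lemma ffall_poly_bigD1 j m :
  ffall_poly m = ffall 'X_j (m j) * \prod_(i | i != j) ffall 'X_i (m i).
Proof. exact: bigD1. Qed.

(** The shift touches only the factor of index [j]. When [m j = 0], truncation in [m - U_(j)] is
    harmless, the coefficient being zero. *)
Lemma fdiff_ffall_poly j m :
  fdiff j (ffall_poly m) = (m j)%:R *: ffall_poly (m - U_(j)).
Proof.
rewrite /fdiff !(ffall_poly_bigD1 j) rmorphM rmorph_ffall rmorph_prod /=.
rewrite comp_mpolyXU -tnth_nth tnth_mktuple eqxx.
rewrite [X in _ * X](_ : _ = \prod_(i | i != j) ffall 'X_i (m i)); last first.
  apply: eq_bigr => i ij; rewrite rmorph_ffall /= comp_mpolyXU -tnth_nth.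
  by rewrite tnth_mktuple (negPf ij) addr0.
rewrite -mulrBl ffall_diff mnmBE mnm1E eqxx subn1 -mulrA mulr_natl scaler_nat.
congr (_ * _ *+ _); apply: eq_bigr => i ij.
by rewrite mnmBE mnm1E eq_sym (negPf ij) subn0.
Qed.

Lemma fdiff_newton j q : fdiff j (newton q) = newton (q^`M(j)).
Proof.
pose F m := newton ('X_[m]^`M(j)).
rewrite -[LHS]/((@fdiff R s j \o newton) q) -[RHS]/((newton \o mderiv j) q).
rewrite !(@mlift_unique _ _ _ F) // => m; rewrite /F //= newtonX.
by rewrite fdiff_ffall_poly mderivX linearZ /= newtonX.
Qed.

Lemma iter_fdiff_newton j n q :
  iter n (@fdiff R s j) (newton q) = newton (iter n (mderiv j) q).
Proof. by elim: n => //= n ->; rewrite fdiff_newton. Qed.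

Lemma multi_iter_fdiff_newton m q :
  multi_iter (@fdiff R s) m (newton q) = newton (q^`M[m]).
Proof.
rewrite /mderivm /multi_iter; elim: (enum 'I_s) => //= j l ->.
exact: iter_fdiff_newton.
Qed.

(** At the origin a nonempty falling factorial contains the factor zero, so only the constant term
    survives. *)
Lemma newton_at0 q : (newton q).@[fun=> 0] = q@_0.
Proof.
rewrite [in RHS](mpolyE q) !raddf_sum; apply: eq_bigr => m _ /=.
rewrite mevalZ mcoeffZ mcoeffX; congr (_ * _).
rewrite meval_ffall_poly; case: (eqVneq m 0%MM) => [->|nz].
  by rewrite big1 // => i _; rewrite mnm0E ffall0.
have [i mi] : exists i, m i != 0%N.
  apply/existsP; apply: contraNT nz => /existsPn h; apply/eqP/mnmP => i.
  by rewrite mnm0E; apply/eqP; move: (h i); rewrite negbK.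
have ff0 : ffall 0 (m i) = 0 :> C by apply: (@ffall_id_ge _ 0); rewrite lt0n.
by rewrite (bigD1 i) //= ff0 mul0r.
Qed.

(** Analogue of Taylor's formula: differences at the origin recover the coefficients in the Newton
    basis. *)
Lemma diff_newton_at0 m q :
  (multi_iter (@fdiff R s) m (newton q)).@[fun=> 0] = q@_m * (mnm_fact m)%:R.
Proof.
rewrite multi_iter_fdiff_newton newton_at0 mcoeff_mderivm addm0 mulr_natr.
by congr (_ *+ _); apply: eq_bigr => i _; rewrite ffactnn.
Qed.

Lemma mnm_fact_neq0 m : (mnm_fact m)%:R != 0 :> C.
Proof. by rewrite pnatr_eq0 -lt0n prodn_gt0 // => i; exact: fact_gt0. Qed.

(** Split [X_j] as [(X_j - m_j) + m_j]; the first term lengthens the falling factorial by one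
    factor. *)
Lemma ffall_poly_mulX j m :
  'X_j * ffall_poly m = ffall_poly (m + U_(j)) + (m j)%:R *: ffall_poly m.
Proof.
rewrite !(ffall_poly_bigD1 j) mnmDE mnm1E eqxx addn1 ffallSr scaler_nat.
rewrite -mulr_natl.
rewrite [X in _ = _ * X + _](_ : _ = \prod_(i | i != j) ffall 'X_i (m i)).
  by ring.
by apply: eq_bigr => i ij; rewrite mnmDE mnm1E eq_sym (negPf ij) addn0.
Qed.

Lemma msize_mlift (F : 'X_{1..s} -> Pi) g d :
    (forall m, m \in msupp g -> (msize (F m) <= d)%N) ->
  (msize (mlift F g) <= d)%N.
Proof.
move=> Fd; apply: leq_trans (msize_sum _ _ _) _.
apply/bigmax_leqP_seq => m mg _; exact: leq_trans (msizeZ_le _ _) (Fd _ mg).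
Qed.

Lemma newton_mulX j g :
  'X_j * newton g =
  newton (mlift (fun k => 'X_[k + U_(j)] + (k j)%:R *: 'X_[k]) g).
Proof.
rewrite mulr_sumr linear_sum; apply: eq_bigr => m _ /=.
by rewrite -scalerAr linearZ linearD linearZ /= !newtonX ffall_poly_mulX.
Qed.

(** Induction on the degree, multiplying by one variable at a time. The size bound matters because
    [opL] sums only up to the degree of its argument. *)
Lemma newton_msize_surj f : exists2 g, newton g = f & (msize g <= msize f)%N.
Proof.
have X m : exists2 g, newton g = 'X_[m] & (msize g <= (mdeg m).+1)%N.
  have [n] := ubnP (mdeg m); elim: n m => // n IH m.
  case: (eqVneq m 0%MM) => [-> _|nz lt_m].
    exists 'X_[0]; last by rewrite msizeX.
    rewrite newtonX mpolyX0 /ffall_poly big1 // => i _.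
    by rewrite mnm0E ffall0.
  have [j mj] : exists j, (U_(j) <= m)%MM.
    apply/existsP; apply: contraNT nz => /existsPn h; apply/eqP/mnmP => i.
    by rewrite mnm0E; apply/eqP; move: (h i); rewrite lep1mP negbK.
  have dm : (mdeg m = (mdeg (m - U_(j))%MM).+1)%N.
    by rewrite -{1}(submK mj) mdegD mdeg1 addn1.
  have [|g gE sg] := IH (m - U_(j))%MM; first by rewrite -ltnS -dm.
  exists (mlift (fun k => 'X_[k + U_(j)] + (k j)%:R *: 'X_[k]) g).
    by rewrite -newton_mulX gE -mpolyXD addmC submK.
  apply: msize_mlift => k kg; apply: leq_trans (msizeD_le _ _) _.
  have dk : (mdeg k < mdeg m)%N.
    by rewrite dm; apply: leq_trans sg; apply: msize_mdeg_lt.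
  rewrite geq_max msizeX mdegD mdeg1 addn1 ltnS dk /=.
  by apply: leq_trans (msizeZ_le _ _) _; rewrite msizeX ltnS ltnW.
pose G m := xget 0 [set g | newton g = 'X_[m] /\ (msize g <= (mdeg m).+1)%N].
have GP m : newton (G m) = 'X_[m] /\ (msize (G m) <= (mdeg m).+1)%N.
  by rewrite /G; case: xgetP => [g _ //|]; have [g ? ? /(_ g) []] := X m.
exists (mlift G f).
  rewrite [RHS]mpolyE linear_sum; apply: eq_bigr => m _ /=.
  by rewrite linearZ /= (GP m).1.
apply: msize_mlift => m mf; apply: leq_trans (GP m).2 _.
exact: msize_mdeg_lt.
Qed.

Lemma mcoeff_opL f m : (opL f)@_m =
  if (mdeg m < msize f)%N
  then (mnm_fact m)%:R^-1 * (multi_iter (@fdiff R s) m f).@[fun=> 0] else 0.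
Proof.
case: ifP => [|/negbT] mf.
  exact: (mcoeff_mpoly (fun m : 'X_{1..s} =>
    (mnm_fact m)%:R^-1 * (multi_iter (@fdiff R s) m f).@[fun=> 0])).
rewrite raddf_sum big1 // => k _ /=; rewrite mcoeffZ mcoeffX.
case: eqP => [km|_]; last by rewrite mulr0.
by rewrite -km (bmdeg k) in mf.
Qed.

(** With [f = newton g], the coefficients of [opL f] are those of [g] up to the degree of [f];
    beyond it both vanish, by the size bound. *)
Lemma opLK f : newton (opL f) = f.
Proof.
have [g gf sg] := newton_msize_surj f; rewrite -{2}gf; congr newton.
apply/mpolyP => m; rewrite mcoeff_opL -{2}gf diff_newton_at0.
case: ltnP => [_|fm]; first by rewrite mulrC mulfK ?mnm_fact_neq0.
by rewrite memN_msupp_eq0 // msize_mdeg_ge // (leq_trans sg).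
Qed.

Lemma newton_inj : injective newton.
Proof.
move=> p q pq; apply/mpolyP => m; apply: (mulIf (mnm_fact_neq0 m)).
by rewrite -!diff_newton_at0 pq.
Qed.

Lemma newtonK q : opL (newton q) = q.
Proof. by apply: newton_inj; rewrite opLK. Qed.

(** Conjugation by [newton] turns differences into derivatives, and [msize (opL p)] of them kill
    [opL p]. *)
Lemma fdiff_nilpotent j p : exists n, iter n (@fdiff R s j) p = 0.
Proof.
rewrite -(opLK p); exists (msize (opL p)); rewrite iter_fdiff_newton.
rewrite -mderivn_iter (_ : _^`M(_, _) = 0) ?linear0 //.
apply/mpolyP => m; rewrite mcoeff_mderivm memN_msupp_eq0 ?mul0rn ?mcoeff0 //.
by rewrite msize_mdeg_ge // mdegD mdegMn mdeg1 mul1n leq_addr.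
Qed.

Lemma meval_fdiff j p (v : 'I_s -> C) :
  (fdiff j p).@[v] = p.@[fun i => v i + (i == j)%:R] - p.@[v].
Proof.
rewrite /fdiff mevalB comp_mpoly_meval; congr (_ - _); apply: meval_eq => i.
by rewrite tnth_mktuple rmorphD /= mevalXU rmorph_nat.
Qed.

Definition int_pt (a : Zs) (i : 'I_s) : C := (a i)%:~R.

Lemma int_pt_unitZ a j :
  int_pt (a + unitZ j) =1 fun i => int_pt a i + (i == j)%:R.
Proof. by move=> i; rewrite /int_pt !ffunE intrD; case: (_ == _). Qed.

(* The Newton coefficients of [p] are determined by its values on [N^s]. *)
Lemma mpoly_eq0_int p : (forall a : Zs, p.@[int_pt a] = 0) -> p = 0.
Proof.
move=> p0; have fdiff0 j q n : (forall a : Zs, q.@[int_pt a] = 0) ->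
    forall a : Zs, (iter n (@fdiff R s j) q).@[int_pt a] = 0.
  move=> q0; elim: n => [|n IH] a //=.
  by rewrite meval_fdiff -(meval_eq _ (int_pt_unitZ a j)) !IH subrr.
rewrite -(opLK p) (_ : opL p = 0) ?linear0 //; apply/mpolyP => m.
apply: (mulIf (mnm_fact_neq0 m)); rewrite -diff_newton_at0 opLK mcoeff0 mul0r.
rewrite (@meval_eq _ _ _ (int_pt 0)); last by move=> i; rewrite /int_pt ffunE.
(* The base point is generalised, as a difference also involves a neighbouring point. *)
rewrite /multi_iter; elim: (enum 'I_s) (0 : Zs) => [|j l IH] a /=.
  exact: p0.
exact: fdiff0.
Qed.

End Newton.

(** * Independence of exponential polynomials *)

Section ExponentialPolynomials.
Variables (R : realType) (s : nat).
Local Notation C := R[i].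
Local Notation Zs := {ffun 'I_s -> int}.
Local Notation Cs := {ffun 'I_s -> C}.
Local Notation Pi := (Cpoly R s).
Implicit Types (a b : Zs) (t theta : Cs) (j : 'I_s) (mu : C) (p q : Pi).

Definition exppoly theta p : ell R s := fun a => p.@[int_pt R a] * e_ theta a.

Lemma exppoly_is_linear theta : linear (exppoly theta).
Proof.
move=> x p q; apply/funext => a; rewrite /exppoly mevalD mevalZ mulrDl.
by rewrite -mulrA.
Qed.

HB.instance Definition _ theta :=
  GRing.isLinear.Build C Pi (ell R s) *:%R (exppoly theta)
    (exppoly_is_linear theta).

Lemma e_N theta a : monom (inv_pt theta) a = e_ theta (- a).
Proof. by apply: eq_bigr => i _; rewrite !ffunE exprz_inv. Qed.

Section Nonzero.
Variables (theta : Cs).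
Hypothesis theta_neq0 : forall i, theta i != 0.

Lemma e_neq0 a : e_ theta a != 0.
Proof. by apply/prodf_neq0 => i _; rewrite expfz_neq0. Qed.

Lemma e_D a b : e_ theta (a + b) = e_ theta a * e_ theta b.
Proof.
by rewrite -big_split; apply: eq_bigr => i _; rewrite ffunE expfzDr.
Qed.

Lemma e_unitZ j : e_ theta (unitZ j) = theta j.
Proof.
rewrite /e_ /monom (bigD1 j) //= ffunE eqxx expr1z big1 ?mulr1 // => i ij.
by rewrite ffunE (negPf ij) expr0z.
Qed.

(** The effect of [c |-> c (_ + unitZ j) - mu * c] on the polynomial factor of [exppoly theta p];
    here [p + fdiff j p] is the shift of [p]. *)
Definition twdiff j mu p : Pi := theta j *: (p + fdiff j p) - mu *: p.

Lemma exppoly_twdiff j mu p a :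
  exppoly theta (twdiff j mu p) a =
  exppoly theta p (a + unitZ j) - mu * exppoly theta p a.
Proof.
rewrite /exppoly e_D e_unitZ (meval_eq _ (int_pt_unitZ R a j)).
by rewrite mevalB !mevalZ mevalD meval_fdiff; ring.
Qed.

(** A [p] in the kernel satisfies [fdiff j p = k *: p] with [k != 0], which nilpotency of [fdiff j]
    allows only for [p = 0]. *)
Lemma twdiff_inj0 j mu p : theta j != mu -> twdiff j mu p = 0 -> p = 0.
Proof.
move=> tmu; pose k := (mu - theta j) / theta j.
have k0 : k != 0 by rewrite mulf_neq0 ?invr_eq0 // subr_eq0 eq_sym.
move=> p0; have Dp : fdiff j p = k *: p.
  apply: (scalerI (theta_neq0 j)); rewrite scalerA mulrC divfK //.
  apply/eqP; rewrite -subr_eq0 scalerBl opprB addrA -p0 /twdiff.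
  by rewrite [theta j *: (p + _)]scalerDr [theta j *: p + _]addrC.
have [n] := fdiff_nilpotent j p.
suff -> : iter n (@fdiff R s j) p = k ^+ n *: p.
  by move/eqP; rewrite scaler_eq0 expf_eq0 (negPf k0) andbF => /eqP.
elim: n => [|n IH]; first by rewrite scale1r.
by rewrite /= IH linearZ /= Dp scalerA exprSr.
Qed.

Lemma iter_twdiff_inj0 j mu n p :
  theta j != mu -> iter n (twdiff j mu) p = 0 -> p = 0.
Proof.
by move=> tmu; elim: n => //= n IH /(twdiff_inj0 tmu).
Qed.

Lemma iter_twdiff_self j n p :
  iter n (twdiff j (theta j)) p = theta j ^+ n *: iter n (@fdiff R s j) p.
Proof.
elim: n => [|n IH]; first by rewrite scale1r.
by rewrite /= IH /twdiff scalerDr addrC addKr linearZ /= scalerA exprS.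
Qed.

End Nonzero.

(** Induction on [l]: a power of a twisted difference kills the head term, and its injectivity at
    [t] gives [p t = 0] on the tail. The head is then alone and vanishes on all integer points. *)
Lemma exppoly_indep (l : seq Cs) (p : Cs -> Pi) :
    uniq l -> (forall t, t \in l -> forall i, t i != 0) ->
    (forall a, \sum_(t <- l) exppoly t (p t) a = 0) ->
  forall t, t \in l -> p t = 0.
Proof.
elim: l p => // theta l IH p /= /andP[thl ul] l0 sum0.
have l0' t : t \in l -> forall i, t i != 0.
  by move=> tl; apply: l0; rewrite inE tl orbT.
have th0 : forall i, theta i != 0 by apply: l0; rewrite inE eqxx.
have pl t : t \in l -> p t = 0.
  move=> tl; have [j tj] : exists j, t j != theta j.
    apply/existsP; apply: contraNT thl => /existsPn h.
    suff -> : theta = t by []; apply/ffunP => j.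
    by apply/esym/eqP; move: (h j); rewrite negbK.
  have [n n0] := fdiff_nilpotent j (p theta).
  apply: (@iter_twdiff_inj0 t (l0' t tl) j (theta j) n) => //.
  (* As [j] and [n] depend on the fixed [t], the induction hypothesis is used anew for each [t], and
     only its conclusion at that [t] is kept. *)
  apply: (IH (fun t => iter n (twdiff t j (theta j)) (p t))) => // a.
  have : \sum_(t <- theta :: l)
           exppoly t (iter n (twdiff t j (theta j)) (p t)) a = 0.
    elim: n {n0} a => [|n IHn] a //=.
    rewrite big_seq (eq_bigr _ (fun t h => exppoly_twdiff (l0 t h) _ _ _ _)).
    by rewrite -big_seq sumrB -mulr_sumr !IHn mulr0 subrr.
  by rewrite big_cons iter_twdiff_self n0 scaler0 linear0 add0r.
move=> t; rewrite inE => /predU1P[->|/pl //].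
apply: mpoly_eq0_int => a; apply: (mulIf (e_neq0 th0 a)).
rewrite mul0r -[LHS]/(exppoly theta (p theta) a) -[RHS](sum0 a).
rewrite big_cons big_seq big1 ?addr0 // => u ul'.
by rewrite pl // linear0.
Qed.

End ExponentialPolynomials.

(** * Linear algebra of functionals and finite generation *)

(** Induction on [r]. If some [v0] is killed by the tail but not by [phi x], subtract from [psi] the
    multiple of [phi x] agreeing with it at [v0]. Otherwise [phi x] vanishes wherever the tail does
    and gets coefficient zero. *)
Lemma scalar_span (K : fieldType) (V : lmodType K) (T : eqType)
    (phi : T -> V -> K) (psi : V -> K) (r : seq T) :
    (forall i, scalar (phi i)) -> scalar psi -> uniq r ->
    (forall v, (forall i, i \in r -> phi i v = 0) -> psi v = 0) ->
  exists c : T -> K, forall v, psi v = \sum_(i <- r) c i * phi i v.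
Proof.
move=> lin_phi.
elim: r psi => [|x r IH] psi lin_psi /= => [_ psi0|/andP[xr ur] psi0].
  by exists (fun=> 0) => v; rewrite big_nil psi0.
have [[v0 phi0 phix]|none] := pselect
    (exists2 v0, (forall i, i \in r -> phi i v0 = 0) & phi x v0 != 0).
  pose k := psi v0 / phi x v0.
  have [|v h|c cE] := IH (fun v => psi v - k * phi x v) _ ur.
  - by move=> a u v; rewrite lin_psi lin_phi; ring.
  (* Correcting [v] by a multiple of [v0] makes [phi x] vanish too. *)
  - have : psi (- (phi x v / phi x v0) *: v0 + v) = 0.
      apply: psi0 => i; rewrite inE lin_phi => /predU1P[->|ir].
        by rewrite mulNr divfK // addNr.
      by rewrite (h i) // (phi0 i) // mulr0 addr0.
    by rewrite lin_psi => <-; rewrite /k; ring.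
  exists (fun i => if i == x then k else c i) => v.
  rewrite big_cons eqxx (eq_big_seq (fun i => c i * phi i v)).
    by rewrite -cE /= addrC subrK.
  by move=> i ir; case: eqP => // ix; rewrite -ix ir in xr.
have [v h|c cE] := IH psi lin_psi ur.
  apply: psi0 => i; rewrite inE => /predU1P[->|/h //].
  by apply/eqP; apply: contrapT => nz; apply: none; exists v => //; apply/negP.
exists (fun i => if i == x then 0 else c i) => v.
rewrite big_cons eqxx mul0r add0r cE.
by apply: eq_big_seq => i ir; case: eqP => // ix; rewrite -ix ir in xr.
Qed.

(** Past the end of [b] the entry is the default [0], which lies in every subspace, so [i] carries
    no bound. *)
Definition generates (K : fieldType) (V : lmodType K) (U : set V) (b : seq V) :=
  (forall i, U b`_i) /\
  forall u, U u -> exists c : nat -> K, u = \sum_(i < size b) c i *: b`_i.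

(* Unlike in [finite_dim], the generators lie in [U]. *)
Lemma finite_dim_generated (K : fieldType) (V : lmodType K) (U : set V) :
  subspace U -> finite_dim U -> exists b : seq V, generates U b.
Proof.
move=> sU [b bU]; elim: b U sU bU => [|x b IH] U [U0 Ulin] bU.
  by exists [::]; split=> [i|//]; rewrite nth_nil.
(* The part of [U] spanned without [x]; at most one more generator [u0] is needed. *)
pose W :=
  [set w | U w /\ exists c : nat -> K, w = \sum_(i < size b) c i *: b`_i].
have [||d [dW dgen]] := IH W.
- split.
    split=> //; exists (fun=> 0).
    by rewrite big1 // => i; rewrite scale0r.
  move=> k u v [Uu [cu uE]] [Uv [cv vE]]; split; first exact: Ulin.
  exists (fun i => k * cu i + cv i); rewrite uE vE scaler_sumr -big_split.
  by apply: eq_bigr => i _; rewrite scalerDl scalerA.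
- by move=> w [].
have Wx u : U u -> exists k : K, exists c : nat -> K,
    u = k *: x + \sum_(i < size b) c i *: b`_i.
  move=> /bU[c ->]; exists (c 0%N), (c \o S).
  by rewrite big_ord_recl.
have [[u0 Uu0 nu0]|none] := pselect (exists2 u0, U u0 & ~ W u0); last first.
  exists d; split=> [i|u Uu]; first by have [] := dW i.
  by apply: dgen; apply: contrapT => nW; apply: none; exists u.
have [k0 [c0 u0E]] := Wx _ Uu0.
have k0N : k0 != 0.
  apply/eqP => k00; apply: nu0; split=> //; exists c0.
  by rewrite u0E k00 scale0r add0r.
exists (u0 :: d); split=> [[|i] //=|u Uu]; first by have [] := dW i.
have [k [c uE]] := Wx _ Uu.
(* The multiple of [u0] cancels the coefficient of [x], leaving an element of [W]. *)
have [|e eE] := dgen ((- (k / k0)) *: u0 + u).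
  split; first exact: Ulin.
  exists (fun i => - (k / k0) * c0 i + c i); rewrite uE u0E.
  rewrite scalerDr scalerA mulNr divfK // addrACA scaleNr addNr add0r.
  rewrite scaler_sumr -big_split; apply: eq_bigr => i _.
  by rewrite scalerDl scalerA.
exists (fun i => if i is i'.+1 then e i' else k / k0).
by rewrite big_ord_recl /= -eE scaleNr addrA subrr add0r.
Qed.

Lemma subspace_sum (K : fieldType) (V : lmodType K) (U : set V) (I : Type)
    (r : seq I) (k : I -> K) (v : I -> V) :
  subspace U -> (forall i, U (v i)) -> U (\sum_(i <- r) k i *: v i).
Proof.
by move=> [U0 Ulin] Uv; elim/big_rec: _ => // i u _ Uu; apply: Ulin.
Qed.

(** * Duality between sequences and Laurent polynomials *)

Section Duality.
Variables (R : realType) (s : nat).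
Local Notation C := R[i].
Local Notation Zs := {ffun 'I_s -> int}.
Local Notation Cs := {ffun 'I_s -> C}.
Local Notation Pi := (Cpoly R s).
Local Notation laurent := (laurent R s).
Implicit Types (a b x : Zs) (z t theta : Cs) (j : 'I_s) (p q : Pi).
Implicit Types (f g : laurent) (c : ell R s) (m k : 'X_{1..s}).

(* The sign makes [h * c] at [a] the pairing of [c] with [z^(-a) h^*]. *)
Definition pair c : laurent -> C := fglift (fun a => c (- a)).

HB.instance Definition _ c := GRing.Linear.on (pair c).

Lemma pair_is_scalar c : scalar (pair c).
Proof. exact: linearP. Qed.

Lemma pairU c (mu : C) a : pair c << mu *g a >> = mu * c (- a).
Proof. exact: liftU. Qed.

Lemma pair_is_linear f : linear (pair^~ f : ell R s -> C).
Proof.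
move=> mu c d; rewrite /pair !fgliftE scaler_sumr -big_split.
apply: eq_bigr => a _; rewrite -[(mu *: c + d) (- a)]/(mu * c (- a) + d (- a)).
by rewrite /GRing.scale /=; ring.
Qed.

Definition pairr f c := pair c f.

HB.instance Definition _ f :=
  GRing.isLinear.Build C (ell R s) C *:%R (pairr f) (pair_is_linear f).

Lemma pairZl (mu : C) c f : pair (mu *: c) f = mu * pair c f.
Proof. by rewrite -[LHS]/(pairr f (mu *: c)) linearZ. Qed.

Lemma pair_suml (I : Type) (r : seq I) (P : pred I) (c : I -> ell R s) f :
  pair (\sum_(i <- r | P i) c i) f = \sum_(i <- r | P i) pair (c i) f.
Proof. by rewrite -[LHS]/(pairr f (\sum_(i <- r | P i) c i)) linear_sum. Qed.

Lemma levalE f z : leval f z = fglift (monom z) f.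
Proof. by rewrite fgliftE. Qed.

(** The transpose of [lderiv j], acting on the values of a functional at monomials. *)
Lemma fglift_lderiv (F : Zs -> C) j f :
  fglift F (lderiv j f) = fglift (fun a => (a j)%:~R * F (a - unitZ j)) f.
Proof.
rewrite /lderiv raddf_sum [RHS]fgliftE; apply: eq_bigr => a _ /=.
by rewrite liftU /GRing.scale /= mulrA.
Qed.

Definition mpow theta k : C := \prod_(i < s) theta i ^+ k i.

Section Nonzero.
Variable theta : Cs.
Hypothesis theta_neq0 : forall i, theta i != 0.

(* The value at [theta^-1] of the [k]-th derivative of the monomial [z^a]. *)
Definition deriv_monom k a : C :=
  mpow theta k * (ffall_poly R k).@[int_pt R a] * e_ theta (- a).

Lemma meval_ffall_polyS k j a :
  (ffall_poly R (k + U_(j))).@[int_pt R a] =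
  (a j)%:~R * (ffall_poly R k).@[int_pt R (a - unitZ j)].
Proof.
rewrite !meval_ffall_poly (bigD1 j) //= [in RHS](bigD1 j) //= mulrA.
rewrite mnmDE mnm1E eqxx addn1 ffallSl /int_pt !ffunE eqxx intrB.
congr (_ * _); apply: eq_bigr => i ij.
by rewrite mnmDE mnm1E !ffunE eq_sym (negPf ij) addn0 subr0.
Qed.

(** Differentiating [z^a] first in [z_j] and then [k] times amounts to the derivative of order
    [k + U_(j)]. *)
Lemma deriv_monomS k j a :
  (a j)%:~R * deriv_monom k (a - unitZ j) = deriv_monom (k + U_(j)) a.
Proof.
rewrite /deriv_monom meval_ffall_polyS opprB [unitZ j - a]addrC.
rewrite e_D // e_unitZ //.
rewrite /mpow [in RHS](bigD1 j) //= [in LHS](bigD1 j) //=.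
rewrite mnmDE mnm1E eqxx addn1 exprS.
rewrite [in RHS](eq_bigr (fun i => theta i ^+ k i)); first by ring.
by move=> i ij; rewrite mnmDE mnm1E eq_sym (negPf ij) addn0.
Qed.

Lemma fglift_iter_lderiv k j n f :
  fglift (deriv_monom k) (iter n (@lderiv R s j) f) =
  fglift (deriv_monom (k + U_(j) *+ n)) f.
Proof.
elim: n k => [|n IH] k; first by rewrite mulm0n addm0.
rewrite /= fglift_lderiv mulmS addmA -IH; congr fglift; apply/funext => a.
exact: deriv_monomS.
Qed.

(** Evaluation is the functional of [deriv_monom 0]; each derivative is absorbed into the index,
    which [foldrE] therefore generalises. *)
Lemma leval_multi_iter m f :
  leval (multi_iter (@lderiv R s) m f) (inv_pt theta) =
  fglift (deriv_monom m) f.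
Proof.
have -> : leval (multi_iter (@lderiv R s) m f) (inv_pt theta) =
          fglift (deriv_monom 0%MM) (multi_iter (@lderiv R s) m f).
  rewrite levalE; congr fglift; apply/funext => a; rewrite e_N /deriv_monom.
  rewrite /mpow meval_ffall_poly !big1 ?mul1r // => i _.
    by rewrite mnm0E ffall0.
  by rewrite mnm0E.
have foldrE l k :
    fglift (deriv_monom k) (foldr (fun i => iter (m i) (@lderiv R s i)) f l) =
    fglift (deriv_monom (k + \big[+%MM/0%MM]_(i <- l) (U_(i) *+ m i)%MM)) f.
  elim: l k => [|i l IH] k /=; first by rewrite big_nil addm0.
  by rewrite fglift_iter_lderiv IH big_cons addmA.
by rewrite foldrE add0m big_enum [in RHS](multinomUE_id m).
Qed.

Lemma leval_lapplyD q f :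
  leval (lapplyD q f) (inv_pt theta) =
  fglift (fun a => \sum_(m <- msupp q) q@_m * deriv_monom m a) f.
Proof.
rewrite levalE /lapplyD linear_sum [RHS]fgliftE.
under eq_bigr => m _ do
  rewrite linearZ /= -levalE leval_multi_iter fgliftE scaler_sumr.
rewrite exchange_big; apply: eq_bigr => a _ /=; rewrite scaler_sumr.
by apply: eq_bigr => m _; rewrite /GRing.scale /= mulrCA.
Qed.

End Nonzero.

(** The element of [P_theta e_theta] coming from [q], with [newton] in place of the inverse of
    [opL]. *)
Definition psi theta q : ell R s :=
  exppoly theta (sigma [ffun=> -1] (newton (sigma theta q))).

Lemma sigma_is_linear theta : linear (@sigma R s theta).
Proof. by move=> mu p q; rewrite /sigma linearP. Qed.

HB.instance Definition _ theta :=
  GRing.isLinear.Build C Pi Pi *:%R (@sigma R s theta) (sigma_is_linear theta).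

Lemma psi_is_linear theta : linear (psi theta).
Proof. by move=> mu p q; rewrite /psi !linearP. Qed.

HB.instance Definition _ theta :=
  GRing.isLinear.Build C Pi (ell R s) *:%R (psi theta) (psi_is_linear theta).

Lemma meval_sigma theta p (v : 'I_s -> C) :
  (sigma theta p).@[v] = p.@[fun i => theta i * v i].
Proof.
rewrite comp_mpoly_meval; apply: meval_eq => i.
by rewrite tnth_mktuple mevalZ mevalXU.
Qed.

Lemma sigmaX theta m : sigma theta 'X_[m] = mpow theta m *: 'X_[m].
Proof.
rewrite /sigma /mpow comp_mpolyX [in RHS]mpolyXE_id -scaler_prod.
by apply: eq_bigr => i _; rewrite tnth_mktuple exprZn.
Qed.

(** [sigma_-] turns the point [- a] into [a], [newton] yields the falling factorials, and
    [sigma theta] the powers of [theta]. *)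
Lemma psiN theta q a :
  psi theta q (- a) = \sum_(m <- msupp q) q@_m * deriv_monom theta m a.
Proof.
rewrite /psi /exppoly meval_sigma (@meval_eq _ _ _ (int_pt R a)); last first.
  by move=> i; rewrite /int_pt !ffunE mulN1r intrN opprK.
rewrite {1}(mpolyE q) (linear_sum (@sigma R s theta)) /=.
rewrite (linear_sum (@newton R s)) (linear_sum (meval (int_pt R a))).
rewrite mulr_suml; apply: eq_bigr => m _ /=.
rewrite [sigma theta (_ *: _)]linearZ /= sigmaX scalerA.
rewrite [newton (_ *: _)]linearZ /= newtonX mevalZ /deriv_monom -!mulrA.
by congr (_ * (_ * (_ * _))).
Qed.

(** Turns the conditions in [zd_ideal] into pairings with sequences; both functionals agree on
    monomials. *)
Lemma leval_psi theta q f : (forall i, theta i != 0) ->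
  leval (lapplyD q f) (inv_pt theta) = pair (psi theta q) f.
Proof.
move=> th0; rewrite leval_lapplyD //; congr fglift; apply/funext => a.
by rewrite psiN.
Qed.

Lemma exp_space_psi (Q : Cs -> set Pi) theta :
  exp_space (P_ Q theta) theta = psi theta @` Q theta.
Proof.
apply/seteqP; split=> c [q0].
  move=> [r [q Qq qr] <-] <-; exists q; first exact: Qq.
  by rewrite /psi qr opLK.
move=> Qq <-; exists (sigma [ffun=> -1] (newton (sigma theta q0))).
  exists (newton (sigma theta q0)); last by [].
  by exists q0; [exact: Qq|rewrite newtonK].
by [].
Qed.

Lemma pair_lmul c f g :
  pair c (lmul f g) =
  \sum_(a <- dom f) coeff a f * pair (fun b => c (b - a)) g.
Proof.
rewrite /lmul !linear_sum; apply: eq_bigr => a _ /=.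
rewrite linear_sum [pair _ g]fgliftE mulr_sumr; apply: eq_bigr => b _ /=.
by rewrite pairU opprD addrC /GRing.scale /= mulrA.
Qed.

Lemma pair_symbol c (h : ell00 R s) a :
  pair (fun b => c (b - a)) (symbol h) = conv h c (- a).
Proof.
rewrite /symbol linear_sum; apply: eq_bigr => b _ /=.
by rewrite pairU addrC.
Qed.

(** Multiplication by a monomial translates [c], so pairings with the ideal are combinations of
    values of [h * c]; a single monomial factor isolates one value. *)
Lemma kernelP (H : {fset ell00 R s}) c :
  kernel H c <->
  forall f, lideal [set symbol h | h in [set` H]] f -> pair c f = 0.
Proof.
split=> [kc _ [n [g [h [Hh ->]]]]|ann h hH].
  rewrite linear_sum big1 // => i _ /=; rewrite pair_lmul big1 // => a _.
  by have [h' h'H <-] := Hh i; rewrite pair_symbol kc ?mulr0.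
apply/funext => a; pose f : laurent := << 1 *g - a >>.
have := ann (lmul f (symbol h)); rewrite pair_lmul domU ?oner_neq0 //.
rewrite big_seq1 pair_symbol coeffU eqxx !mul1r opprK; apply.
exists 1%N, (fun=> f), (fun=> symbol h); split; last by rewrite big_ord1.
by move=> _; exists h.
Qed.

End Duality.

(** * The kernel as a direct sum *)

Theorem theorem2p9 (R : realType) (s : nat) (hs : (0 < s)%N)
    (H : {fset ell00 R s}) (Theta : {fset {ffun 'I_s -> R[i]}})
    (Q : {ffun 'I_s -> R[i]} -> set (Cpoly R s))
    (hH : zero_dimensional H Theta Q) :
  is_direct_sum Theta (fun theta => exp_space (P_ Q theta) theta) (kernel H).
Proof.
case: hH => th0 subQ _ finQ _ idealP.
split.
- move=> theta /subQ[Q0 Qlin]; rewrite exp_space_psi; split.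
    by exists 0; rewrite ?linear0.
  move=> mu _ _ [p Qp <-] [q Qq <-]; exists (mu *: p + q); first exact: Qlin.
  by rewrite linearP.
- apply/seteqP; split=> c.
    move=> /kernelP kc.
    (* Stated for all points so that choice applies; outside [Theta] the empty list serves. *)
    have genQ theta : exists b, theta \in Theta -> generates (Q theta) b.
      have [thT|] := boolP (theta \in Theta); last by exists [::].
      have [b hb] := finite_dim_generated (subQ _ thT) (finQ _ thT).
      by exists b.
    have [b bP] := choice genQ.
    pose r := [seq (theta, i) | theta <- Theta, i <- iota 0 (size (b theta))].
    have ur : uniq r.
      apply: allpairs_uniq_dep => [|? _|].
      - exact: fset_uniq.
      - exact: iota_uniq.
      - by move=> [? ?] [? ?] _ _ [-> ->].
    (* An [f] killed by all generators meets the conditions of [zd_ideal], so it lies in the ideal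
       and [c] kills it. *)
    have [f h|k kE] := scalar_span
        (fun x => pair_is_scalar (psi x.1 (b x.1)`_x.2)) (pair_is_scalar c) ur.
      apply/kc/idealP => theta thT q Qq.
      rewrite leval_psi; last exact: th0.
      have [_ /(_ _ Qq)[k ->]] := bP _ thT.
      rewrite linear_sum pair_suml big1 // => i _ /=.
      rewrite linearZ /= pairZl.
      suff -> : pair (psi theta (b theta)`_i) f = 0 by rewrite mulr0.
      apply: (h (theta, nat_of_ord i)).
      by apply: allpairs_f_dep; rewrite // mem_iota ltn_ord.
    exists (fun theta => psi theta
      (\sum_(i <- iota 0 (size (b theta))) k (theta, i) *: (b theta)`_i)).
      move=> theta thT; rewrite exp_space_psi; eexists; last by [].
      by apply: subspace_sum; [exact: subQ|have [] := bP _ thT].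
    (* Pairing with the monomial of exponent [- a] reads off the value at [a]. *)
    apply/funext => a; have := kE << 1 *g - a >>.
    rewrite pairU mul1r opprK => ->; rewrite big_allpairs_dep fct_sumE.
    apply: eq_bigr => theta _; rewrite linear_sum fct_sumE.
    by apply: eq_bigr => i _; rewrite linearZ pairU mul1r opprK.
  move=> [u Eu ->]; apply/kernelP => f /idealP If.
  rewrite pair_suml big_seq big1 // => theta thT /=.
  have := Eu _ thT; rewrite exp_space_psi => -[q Qq <-].
  by rewrite -leval_psi; [exact: If|exact: th0].
move=> u v Eu Ev uv.
(* Uniqueness reduces to independence, since each difference of summands is an exponential
   polynomial. *)
have diffE theta : exists p,
    theta \in Theta -> u theta - v theta = exppoly theta p.
  have [thT|] := boolP (theta \in Theta); last by exists 0.
  have [p _ <-] := Eu _ thT; have [q _ <-] := Ev _ thT.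
  by exists (p - q); rewrite linearB.
have [p pE] := choice diffE => theta thT.
apply/eqP; rewrite -subr_eq0 pE // (@exppoly_indep _ _ Theta p) ?linear0 //.
  exact: fset_uniq.
move=> a; transitivity ((\sum_(t <- Theta) (u t - v t)) a).
  by rewrite fct_sumE; apply: eq_big_seq => t tT; rewrite pE.
by rewrite sumrB uv subrr.
Qed.
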